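(* Let $\mathcal{I}$ be a proper $\sigma$-ideal of subsets of $\mathbb{R}$ which contains all singletons, has a Borel base and is translation invariant. Let $\mathcal{P}$ be a partition of $\mathbb{R}$ all of whose members are finite sets. Then (1) there is $\mathcal{A}_0\subseteq\mathcal{P}$ such that $\bigcup\mathcal{A}_0$ is completely $\mathcal{I}$-nonmeasurable; (2) there is $\mathcal{A}_1\subseteq\mathcal{P}$ such that $\bigcup\mathcal{A}_1$ is $\mathcal{I}$-nonmeasurable but is not completely $\mathcal{I}$-nonmeasurable.
   Context: $\mathcal{I}$ has a Borel base if every $I\in\mathcal{I}$ is contained in some Borel set $B\in\mathcal{I}$. $\mathcal{I}$ is translation invariant if $x+I=\{x+i: i\in I\}\in\mathcal{I}$ for all $I\in\mathcal{I}$ and $x\in\mathbb{R}$. A set $A\subseteq\mathbb{R}$ is $\mathcal{I}$-nonmeasurable if it does not belong to the $\sigma$-algebra generated by the Borel sets and $\mathcal{I}$. It is completely $\mathcal{I}$-nonmeasurable if $A\cap B$ is $\mathcal{I}$-nonmeasurable for every Borel set $B\notin\mathcal{I}$. A partition of $\mathbb{R}$ is a family of nonempty pairwise disjoint sets with union $\mathbb{R}$. *)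

(* Defs.v *)
From mathcomp Require Import all_boot all_order all_algebra.
From mathcomp Require Import all_classical all_reals all_analysis.

Set Implicit Arguments.
Unset Strict Implicit.
Unset Printing Implicit Defensive.

Import Order.TTheory GRing.Theory Num.Theory.
Import numFieldNormedType.Exports.

Local Open Scope classical_set_scope.
Local Open Scope ring_scope.

Record sigma_ideal (T : Type) (I : set (set T)) : Prop := SigmaIdeal {
  sigma_ideal0 : I set0 ;
  sigma_idealS : forall A B : set T, A `<=` B -> I B -> I A ;
  sigma_idealU : forall F : nat -> set T,
    (forall n, I (F n)) -> I (\bigcup_n F n) }.

Definition proper_set_ideal (T : Type) (I : set (set T)) : Prop := ~ I [set: T].

Definition contains_singletons (T : Type) (I : set (set T)) : Prop :=
  forall x : T, I [set x].

Definition borel (R : realType) : set (set R) := <<s [set U : set R | open U] >>.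
Arguments borel : clear implicits.

Definition has_borel_base (R : realType) (I : set (set R)) : Prop :=
  forall A, I A -> exists B, [/\ borel R B, I B & A `<=` B].

Definition translation_invariant (R : realType) (I : set (set R)) : Prop :=
  forall (A : set R) (x : R), I A -> I [set x + a | a in A].

Definition nonmeasurable (R : realType) (I : set (set R)) (A : set R) : Prop :=
  ~ <<s borel R `|` I >> A.

Definition completely_nonmeasurable (R : realType) (I : set (set R))
    (A : set R) : Prop :=
  forall B, borel R B -> ~ I B -> nonmeasurable I (A `&` B).

(* Main.v *)
Require Import Defs.
From mathcomp Require Import all_boot all_order all_algebra.
From mathcomp Require Import all_classical all_reals all_analysis.
From Stdlib Require Inverse_Image.
From mathcomp Require wochoice.
From mathcomp Require Import lra.

Set Implicit Arguments.
Unset Strict Implicit.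
Unset Printing Implicit Defensive.

Import Order.TTheory GRing.Theory Num.Theory.
Import numFieldNormedType.Exports.

Local Open Scope classical_set_scope.
Local Open Scope ring_scope.

(** The first set is a Bernstein-type union. Every Borel set outside [I] is
    uncountable, hence contains a copy of the Cantor set, and such copies can
    be coded by only continuum many objects. Each copy meets continuum many
    members of [P], because the members of [P] are finite. A transfinite
    recursion of length continuum therefore chooses, for each coded copy, two
    members of [P] meeting it, all choices being distinct. If [A0] collects one
    of the two choices for every copy, then the union of [A0] and its complement
    both meet every Borel set outside [I]. A measurable set differs from a Borel
    set only inside a Borel member of [I], so no such union can be measurable
    inside a Borel set outside [I]. The copy of the Cantor set comes from
    [perfect_kernel], the choice of [A0] is [bernstein_union], which rests on
    [continuum_many_image] and [injective_transversal], and
    [completely_nonmeasurable_meets] concludes.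

    The second set is obtained by staying off a half-line. By translation
    invariance no half-line [k, +oo) is in [I]. A finite set is disjoint from
    [k, +oo) once [k] is large, so the sets [N k], where [N k] is the union of
    the members of [P] disjoint from [k, +oo), cover the line as [k] ranges over
    the naturals, and some [N k] is outside [I]. If this [N k] is not measurable,
    it is the required union. If it is measurable, it contains a Borel set
    outside [I]; there the members of [A0] lying in [N k] have the same trace as
    all of [A0], so their union is nonmeasurable. Either union misses the
    half-line, hence is not completely nonmeasurable. *)

(** * Ideals and measurability modulo an ideal *)

Lemma sigma_ideal_bigcup (T : Type) (K : countType) (I : set (set T))
    (F : K -> set T) :
  sigma_ideal I -> (forall k, I (F k)) -> I (\bigcup_k F k).
Proof.
move=> idI IF.
pose G n := if unpickle n is Some k then F k else set0.
apply: (sigma_idealS idI (B := \bigcup_n G n)).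
  by move=> x [k _ Fkx]; exists (pickle k) => //; rewrite /G pickleK.
apply: (sigma_idealU idI) => n; rewrite /G.
by case: (unpickle n) => [k|]; [exact: IF|exact: sigma_ideal0 idI].
Qed.

Lemma sigma_ideal_setU (T : Type) (I : set (set T)) (A B : set T) :
  sigma_ideal I -> I A -> I B -> I (A `|` B).
Proof.
move=> idI IA IB.
apply: (sigma_idealS idI (B := \bigcup_(b : bool) (if b then A else B))).
  by move=> x [Ax|Bx]; [exists true|exists false].
by apply: sigma_ideal_bigcup => // -[].
Qed.

Lemma sigma_algebraI (T : pointedType) (G : set (set T)) (A B : set T) :
  <<s G >> A -> <<s G >> B -> <<s G >> (A `&` B).
Proof. exact: (@measurableI _ (g_sigma_algebraType G)). Qed.

Lemma sigma_algebraD (T : pointedType) (G : set (set T)) (A B : set T) :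
  <<s G >> A -> <<s G >> B -> <<s G >> (A `\` B).
Proof. exact: (@measurableD _ (g_sigma_algebraType G)). Qed.

(** The Borel base lets the exceptional set [J] be Borel, so that it can be
    removed from a Borel set without leaving the Borel sets. *)
Lemma measurable_mod_ideal (R : realType) (I : set (set R)) (A : set R) :
  sigma_ideal I -> has_borel_base I -> <<s borel R `|` I >> A ->
  exists C J, [/\ borel R C, borel R J, I J &
    forall x, ~ J x -> (A x <-> C x)].
Proof.
move=> idI baseI; move: A; apply: smallest_sub.
  split.
  - by exists set0, set0; split=> //; [exact: sigma_algebra0|
      exact: sigma_algebra0|exact: sigma_ideal0 idI].
  - move=> A [C [J [bC bJ IJ AC]]]; exists (setT `\` C), J; split=> //.
      exact: sigma_algebraCD.
    by move=> x nJx; rewrite /setD/=; have := AC x nJx; tauto.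
  - move=> A /choice[C /choice[J CJ]].
    exists (\bigcup_n C n), (\bigcup_n J n); split.
    + by apply: sigma_algebra_bigcup => n; case: (CJ n).
    + by apply: sigma_algebra_bigcup => n; case: (CJ n).
    + by apply: (sigma_idealU idI) => n; case: (CJ n).
    + move=> x nJ; split=> -[n _ nx]; exists n => //; case: (CJ n) => _ _ _ H.
        by apply/H => // Jx; apply: nJ; exists n.
      by apply/(H x) => // Jx; apply: nJ; exists n.
move=> A [bA|IA].
  by exists A, set0; split=> //; [exact: sigma_algebra0|exact: sigma_ideal0 idI].
have [J [bJ IJ AJ]] := baseI _ IA.
exists set0, J; split=> //; first exact: sigma_algebra0.
by move=> x nJ; split=> // /AJ.
Qed.

(** If [A `&` B] agreed with a Borel set [C] outside [J], then [C `\` J] would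
    be a Borel subset of [A], hence in [I] because the complement of [A] meets
    every Borel set outside [I]; then [B] without [C] and [J] would be a Borel
    set outside [I] that [A] misses. *)
Lemma completely_nonmeasurable_meets (R : realType) (I : set (set R))
    (A : set R) :
  sigma_ideal I -> has_borel_base I ->
  (forall B, borel R B -> ~ I B -> A `&` B !=set0) ->
  (forall B, borel R B -> ~ I B -> ~` A `&` B !=set0) ->
  completely_nonmeasurable I A.
Proof.
move=> idI baseI Am ACm B bB nIB mAB.
have [C [J [bC bJ IJ ABC]]] := measurable_mod_ideal idI baseI mAB.
have [ICJ|nICJ] := pselect (I (C `\` J)); last first.
  have [x [nAx [Cx nJx]]] := ACm _ (sigma_algebraD bC bJ) nICJ.
  by apply: nAx; have [] := (ABC x nJx).2 Cx.
have ICUJ : I (C `\` J `|` J) by exact: sigma_ideal_setU.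
have bCUJ : borel R (C `\` J `|` J).
  exact: (@measurableU _ (g_sigma_algebraType _)) (sigma_algebraD bC bJ) bJ.
have nID : ~ I (B `\` (C `\` J `|` J)).
  move=> ID; apply: nIB.
  apply: (sigma_idealS idI _ (sigma_ideal_setU idI ID ICUJ)) => x Bx.
  by have [?|?] := pselect ((C `\` J `|` J) x); [right|left].
have [x [Ax [Bx []]]] := Am _ (sigma_algebraD bB bCUJ) nID.
have [Jx|nJx] := pselect (J x); [by right|left; split=> //].
exact/ABC.
Qed.

(** * Borel sets are analytic *)

(** Closedness of [Z] in the product of the line with the Baire space, spelled
    out on basic neighbourhoods, which is the form in which it is both
    established and used. *)
Definition closed_with_sequence (R : realType) (Z : R -> (nat -> nat) -> Prop) :=
  forall x a,
    (forall (e : R) (n : nat), 0 < e -> exists y b,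
      [/\ Z y b, `|x - y| < e & forall k, (k < n)%N -> b k = a k]) ->
    Z x a.

Definition analytic (R : realType) (A : set R) :=
  exists Z, closed_with_sequence Z /\ A = [set x | exists a, Z x a].

(** [U] is the union over [n] of the closed sets of points at distance at least
    1 / n.+1 from the complement of [U]; [a 0] names such an [n]. *)
Lemma analytic_open (R : realType) (U : set R) : open U -> analytic U.
Proof.
move=> oU.
exists (fun x a => forall y, `|x - y| < (a 0%N).+1%:R^-1 -> U y); split.
  move=> x a xa y xy.
  have e0 : 0 < (a 0%N).+1%:R^-1 - `|x - y| by rewrite subr_gt0.
  have [z [b [Zzb xz b0]]] := xa _ 1%N e0.
  apply: Zzb; rewrite b0//.
  rewrite (le_lt_trans (ler_distD x _ _))// distrC.
  by rewrite -ltrBrDr.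
apply/seteqP; split=> [x Ux|x [a]]; last by apply; rewrite subrr normr0 invr_gt0.
have /nbhs_ballP[e /= e0 xe] := open_nbhs_nbhs (conj oU Ux).
have [n] := ltr_add_invr (e0 : 0 < e).
rewrite add0r => ne; exists (fun=> n) => y xy; apply: xe.
by rewrite /ball/= (lt_trans xy).
Qed.

Lemma analytic_setC_open (R : realType) (U : set R) :
  open U -> analytic (~` U).
Proof.
move=> oU; exists (fun x _ => ~ U x); split; last first.
  by apply/seteqP; split=> [x ? | x [_ ]//]; exists (fun=> 0%N).
move=> x a xa Ux.
have /nbhs_ballP[e /= e0 xe] := open_nbhs_nbhs (conj oU Ux).
have [y [b [nUy xy _]]] := xa e 0%N e0.
exact/nUy/xe.
Qed.

(** The first term of the sequence says which [A n] the point belongs to, and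
    the remaining terms witness it. *)
Lemma analytic_bigcup (R : realType) (A : nat -> set R) :
  (forall n, analytic (A n)) -> analytic (\bigcup_n A n).
Proof.
move=> /choice[Z ZA].
exists (fun x a => Z (a 0%N) x (fun k => a k.+1)); split.
  move=> x a xa; apply: (ZA (a 0%N)).1 => e n e0.
  have [y [b [Zyb xy ba]]] := xa e n.+1 e0.
  exists y, (fun k => b k.+1); split=> //; first by rewrite -ba.
  by move=> k kn; rewrite ba.
apply/seteqP; split=> [x [n _]|x [a Zxa]].
  rewrite {1}(ZA n).2 => -[a Zxa].
  by exists (fun k => if k is k'.+1 then a k' else n).
by exists (a 0%N) => //; rewrite (ZA _).2; exists (fun k => a k.+1).
Qed.

(** One sequence codes a witness for every [A m], along a pairing of the
    naturals. *)
Lemma analytic_bigcap (R : realType) (A : nat -> set R) :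
  (forall n, analytic (A n)) -> analytic (\bigcap_n A n).
Proof.
move=> /choice[Z ZA].
exists (fun x a => forall m, Z m x (fun k => a (pickle (m, k)))); split.
  move=> x a xa m; apply: (ZA m).1 => e n e0.
  (* Agreement up to this bound controls the first [n] terms of row [m]. *)
  have [y [b [Zyb xy ba]]] :=
    xa e (\max_(k < n) pickle (m, nat_of_ord k)).+1 e0.
  exists y, (fun k => b (pickle (m, k))); split=> // k kn.
  by rewrite ba// ltnS (leq_bigmax (Ordinal kn)).
apply/seteqP; split=> [x Ax|x [a Zxa] m _]; last first.
  by rewrite (ZA m).2; exists (fun k => a (pickle (m, k))).
have /choice[a Zxa] m : exists a, Z m x a.
  by have := Ax m I; rewrite (ZA m).2.
exists (fun i => if unpickle i is Some mk then a mk.1 mk.2 else 0%N) => m.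
suff -> : (fun k => if unpickle (pickle (m, k)) is Some mk
                    then a mk.1 mk.2 else 0%N) = a m by [].
by apply/funext => k; rewrite pickleK.
Qed.

(** Analytic sets are not closed under complement, so the induction carries the
    complement along. *)
Lemma borel_analytic (R : realType) (B : set R) : borel R B -> analytic B.
Proof.
suff : borel R `<=` [set A | analytic A /\ analytic (~` A)].
  by move=> sub /sub[].
apply: smallest_sub => [|U /= oU]; last first.
  by split; [exact: analytic_open|exact: analytic_setC_open].
split.
- split; first exact/analytic_open/open0.
  by rewrite setC0; exact/analytic_open/openT.
- by move=> A [aA aCA]; rewrite setTD; split=> //; rewrite setCK.
- move=> A aA; split; first by apply: analytic_bigcup => n; case: (aA n).
  by rewrite setC_bigcup; apply: analytic_bigcap => n; case: (aA n).
Qed.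

(** * The perfect set theorem for analytic sets *)

Definition continuum_many (T : Type) (A : set T) :=
  exists f : (nat -> bool) -> T, injective f /\ forall z, A (f z).

(** Prefixes are stored last letter first, so that extending a branch is a
    [cons] and schemes can be defined by structural recursion. *)
Fixpoint rev_prefix (z : nat -> bool) (n : nat) : seq bool :=
  if n is m.+1 then z m :: rev_prefix z m else [::].

(** For the schemes built below this is a copy of the Cantor set. It is coded by
    a function between countable types, so there are only continuum many sets of
    this form. *)
Definition branch_limits (R : realType) (c : seq bool -> rat) : set R :=
  [set x | exists z, forall n,
    `|x - ratr (c (rev_prefix z n.+1))| <= n.+1%:R^-1].

Lemma size_rev_prefix z n : size (rev_prefix z n) = n.
Proof. by elim: n => //= n ->. Qed.

Lemma rev_prefix_split (z z' : nat -> bool) : z <> z' ->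
  exists n, rev_prefix z n = rev_prefix z' n /\ z n <> z' n.
Proof.
move=> zz'; have /existsNP[k zk] : ~ forall k, z k = z' k.
  by move=> /funext.
have [|n zn nmin] := @ex_minnP (fun k => z k != z' k); first by exists k; exact/eqP.
exists n; split; last exact/eqP.
have : forall m, (m < n)%N -> z m = z' m.
  move=> m mn; apply/eqP; apply: contraLR mn => /nmin; by rewrite -leqNgt.
elim: n {zn nmin} => //= n IH zz; rewrite zz// IH// => m mn.
by apply: zz; rewrite ltnS ltnW.
Qed.

Lemma rat_approx (R : realType) (x e : R) : 0 < e ->
  exists q : rat, `|x - ratr q| <= e.
Proof.
move=> e0; have [q] : exists q : rat, ratr q \in `]x, (x + e)[.
  by apply: rat_in_itvoo; rewrite ltrDl.
rewrite in_itv/= => /andP[xq qx]; exists q.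
by rewrite distrC ger0_norm ?subr_ge0 ?ltW// ltrBlDl.
Qed.

(** Otherwise, for rational [p < q], either the part of [A] below [p] or the
    part above [q] is in [I]. Removing from [A] all the rational lower and upper
    parts that are in [I] leaves at most one point. *)
Lemma cut_positive (R : realType) (I : set (set R)) (A : set R) :
  sigma_ideal I -> contains_singletons I -> ~ I A ->
  exists t1 t2 : R, [/\ t1 < t2, ~ I [set x | A x /\ x <= t1] &
    ~ I [set x | A x /\ t2 <= x]].
Proof.
move=> idI sI nIA; apply: contrapT => nt.
pose L q : set R := [set x | A x /\ x <= q].
pose U q : set R := [set x | A x /\ q <= x].
have LU t1 t2 : t1 < t2 -> I (L t1) \/ I (U t2).
  move=> t12; have [?|nL] := pselect (I (L t1)); first by left.
  have [?|nU] := pselect (I (U t2)); first by right.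
  by exfalso; apply: nt; exists t1, t2.
pose F (q : rat) : set R :=
  [set x | I (L (ratr q)) /\ L (ratr q) x] `|` [set x | I (U (ratr q)) /\ U (ratr q) x].
have IF : I (\bigcup_q F q).
  apply: sigma_ideal_bigcup => // q; apply: sigma_ideal_setU => //.
    have [IL|nIL] := pselect (I (L (ratr q))).
      by apply: (sigma_idealS idI _ IL) => x [].
    by apply: (sigma_idealS idI _ (sigma_ideal0 idI)) => x [].
  have [IU|nIU] := pselect (I (U (ratr q))).
    by apply: (sigma_idealS idI _ IU) => x [].
  by apply: (sigma_idealS idI _ (sigma_ideal0 idI)) => x [].
have core x y : A x -> A y -> x < y ->
    (\bigcup_q F q) x \/ (\bigcup_q F q) y.
  move=> Ax Ay xy.
  have [p] := rat_in_itvoo xy; rewrite in_itv/= => /andP[xp py].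
  have [q] := rat_in_itvoo py; rewrite in_itv/= => /andP[pq qy].
  have [IL|IU] := LU _ _ pq.
    by left; exists p => //; left; split=> //; split=> //; exact: ltW.
  by right; exists q => //; right; split=> //; split=> //; exact: ltW.
have [[x [Ax nFx]]|none] := pselect (exists x, A x /\ ~ (\bigcup_q F q) x).
  apply: nIA; apply: (sigma_idealS idI _ (sigma_ideal_setU idI IF (sI x))).
  move=> y Ay; have [?|nFy] := pselect ((\bigcup_q F q) y); [by left|right].
  by case: (ltgtP x y) => // xy; case: (core _ _ _ _ xy).
apply: nIA; apply: (sigma_idealS idI _ IF) => x Ax.
by apply: contrapT => nFx; apply: none; exists x.
Qed.

(** The projection of [E] is covered by the countably many pieces indexed by the
    value [v] and the rational [q]. *)
Lemma localize_positive (R : realType) (I : set (set R))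
    (E : set (R * (nat -> nat))) (n : nat) :
  sigma_ideal I -> ~ I (fst @` E) ->
  exists (v : nat) (q : rat),
    ~ I (fst @` [set w | [/\ E w, w.2 n = v & `|w.1 - ratr q| <= n.+1%:R^-1]]).
Proof.
move=> idI nIE; apply: contrapT => nvq; apply: nIE.
pose F (vq : nat * rat) : set R :=
  fst @` [set w | [/\ E w, w.2 n = vq.1 & `|w.1 - ratr vq.2| <= n.+1%:R^-1]].
apply: (sigma_idealS idI (B := \bigcup_vq F vq)).
  move=> _ [w Ew <-].
  have [|q wq] := @rat_approx R w.1 n.+1%:R^-1; first by rewrite invr_gt0.
  by exists (w.2 n, q) => //; exists w.
apply: sigma_ideal_bigcup => // -[v q].
by apply: contrapT => nF; apply: nvq; exists v, q.
Qed.

(** One splitting step of the Cantor scheme. A node consists of a set of pairs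
    with projection outside [I], the common value at [n] of its sequences, and a
    rational approximating its points. The thresholds [t1 < t2] keep the two
    halves apart even after passing to limits. *)
Lemma split_positive (R : realType) (I : set (set R))
    (E : set (R * (nat -> nat))) (n : nat) :
  sigma_ideal I -> contains_singletons I -> ~ I (fst @` E) ->
  exists N : bool -> set (R * (nat -> nat)) * nat * rat,
    (forall b, [/\ ~ I (fst @` (N b).1.1), (N b).1.1 `<=` E &
       forall w, (N b).1.1 w ->
         w.2 n = (N b).1.2 /\ `|w.1 - ratr (N b).2| <= n.+1%:R^-1]) /\
    exists t1 t2, [/\ t1 < t2, forall w, (N false).1.1 w -> w.1 <= t1 &
      forall w, (N true).1.1 w -> t2 <= w.1].
Proof.
move=> idI sI nIE; have [t1 [t2 [t12 n1 n2]]] := cut_positive idI sI nIE.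
pose D b := [set w | E w /\ (if b then t2 <= w.1 else w.1 <= t1)].
have nID b : ~ I (fst @` D b).
  move=> ID; case: b ID => ID.
    by apply: n2; apply: (sigma_idealS idI _ ID) => _ [[w Ew <-] tw]; exists w.
  by apply: n1; apply: (sigma_idealS idI _ ID) => _ [[w Ew <-] tw]; exists w.
have /choice[v /choice[q vq]] b := localize_positive n idI (nID b).
exists (fun b => ([set w | [/\ D b w, w.2 n = v b &
  `|w.1 - ratr (q b)| <= n.+1%:R^-1]], v b, q b)); split=> /=.
  by move=> b; split=> //; [move=> w [[]]|move=> w []].
by exists t1, t2; split=> // w [[]].
Qed.

(** Iterating [split_positive] from the closed set [Z] projecting to [A] gives a
    binary tree of nonempty sets. Along a branch [z] the first coordinates
    converge and the sequences stabilise, so the limit lies in [A] as [Z] is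
    closed; distinct branches are separated by the thresholds of the node where
    they part. Smallness is measured by an arbitrary sigma-ideal containing the
    points; for the ideal of countable sets this is the classical theorem. *)
Lemma perfect_kernel (R : realType) (I : set (set R)) (A : set R) :
  sigma_ideal I -> contains_singletons I -> analytic A -> ~ I A ->
  exists c, branch_limits c `<=` A /\ continuum_many (branch_limits c : set R).
Proof.
move=> idI sI [Z [cZ AZ]] nIA.
pose node := (set (R * (nat -> nat)) * nat * rat)%type.
have /choice[step stepP] (nE : nat * set (R * (nat -> nat))) :
    exists N : bool -> node, ~ I (fst @` nE.2) ->
    (forall b, [/\ ~ I (fst @` (N b).1.1), (N b).1.1 `<=` nE.2 &
       forall w, (N b).1.1 w ->
         w.2 nE.1 = (N b).1.2 /\ `|w.1 - ratr (N b).2| <= nE.1.+1%:R^-1]) /\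
    exists t1 t2, [/\ t1 < t2, forall w, (N false).1.1 w -> w.1 <= t1 &
      forall w, (N true).1.1 w -> t2 <= w.1].
  case: nE => n E /=; have [IE|nIE] := pselect (I (fst @` E)).
    by exists (fun=> (set0, 0%N, 0)).
  by have [N NP] := split_positive n idI sI nIE; exists N.
pose fix scheme (s : seq bool) : node :=
  if s is b :: s' then step (size s', (scheme s').1.1) b
  else ([set w | Z w.1 w.2], 0%N, 0).
pose E z n := (scheme (rev_prefix z n)).1.1.
pose v z n := (scheme (rev_prefix z n)).1.2.
pose c s := (scheme s).2.
have ES z n : scheme (rev_prefix z n.+1) = step (n, E z n) (z n).
  by rewrite /= size_rev_prefix.
have Epos z n : ~ I (fst @` E z n).
  elim: n => [|n IH].
    move=> IZ; apply: nIA; apply: (sigma_idealS idI _ IZ) => x.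
    by rewrite AZ => -[a Zxa]; exists (x, a).
  by rewrite {1}/E ES; have [/(_ (z n))[]] := stepP (n, E z n) IH.
have Edec z n m : (n <= m)%N -> E z m `<=` E z n.
  elim: m => [|m IH]; first by rewrite leqn0 => /eqP ->.
  rewrite leq_eqVlt => /orP[/eqP -> //|/IH EE]; apply: subset_trans EE.
  by rewrite {1}/E ES; have [/(_ (z m))[]] := stepP (m, E z m) (Epos z m).
have Eloc z n w : E z n.+1 w ->
    w.2 n = v z n.+1 /\ `|w.1 - ratr (c (rev_prefix z n.+1))| <= n.+1%:R^-1.
  rewrite /E /v /c ES => Ew.
  by have [/(_ (z n))[_ _ /(_ w Ew)]] := stepP (n, E z n) (Epos z n).
have Ene z n : exists w, E z n w.
  apply: contrapT => nw; apply: (Epos z n).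
  apply: (sigma_idealS idI _ (sigma_ideal0 idI)) => x [w Ew _].
  by apply: nw; exists w.
(* A point tracked by [c] along [z] is a limit of points of the [E z m]. *)
have Elim z x : (forall n, `|x - ratr (c (rev_prefix z n.+1))| <= n.+1%:R^-1) ->
    forall (e : R) m, 0 < e -> exists2 w, E z m w & `|x - w.1| < e.
  move=> xz e m e0; have [k] := ltr_add_invr (divr_gt0 e0 (ltr0n R 2)).
  rewrite add0r => ke; have [w Ew] := Ene z (maxn m k.+1).
  exists w; first exact: Edec (leq_maxl _ _) _ Ew.
  have [_ wq] := Eloc _ _ _ (Edec _ _ _ (leq_maxr _ _) _ Ew).
  rewrite [e]splitr (le_lt_trans (ler_distD (ratr (c (rev_prefix z k.+1))) _ _))//.
  apply: ltrD; first exact: le_lt_trans (xz _) ke.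
  by rewrite distrC; exact: le_lt_trans wq ke.
exists c; split.
  move=> x [z xz]; rewrite AZ; exists (fun n => v z n.+1).
  apply: cZ => e n e0; have [w Ew xw] := Elim z x xz e n e0.
  exists w.1, w.2; split=> //; first exact: (Edec z 0%N n) Ew.
  by move=> k kn; have [] := Eloc _ _ _ (Edec _ _ _ kn _ Ew).
have /choice[f fP] z : exists x : R, forall n,
    `|x - ratr (c (rev_prefix z n.+1))| <= n.+1%:R^-1.
  pose q n : R := ratr (c (rev_prefix z n.+1)).
  have qq n m : q n - n.+1%:R^-1 <= q m + m.+1%:R^-1.
    have [w Ew] := Ene z (maxn n.+1 m.+1).
    have [_ wn] := Eloc _ _ _ (Edec _ _ _ (leq_maxl _ _) _ Ew).
    have [_ wm] := Eloc _ _ _ (Edec _ _ _ (leq_maxr _ _) _ Ew).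
    move: wn wm; rewrite !ler_distl -/(q n) -/(q m) => /andP[+ _] /andP[_].
    exact: le_trans.
  (* The intervals of radius n.+1%:R^-1 around [q n] meet pairwise by [qq], and
     the supremum of their left ends belongs to all of them. *)
  pose S := [set q n - n.+1%:R^-1 | n in setT].
  have Sub m : ubound S (q m + m.+1%:R^-1) by move=> _ [n _ <-].
  exists (sup S) => n; rewrite ler_distl; apply/andP; split.
    by apply: ub_le_sup; [exists (q 0%N + 1%:R^-1); exact: Sub|exists n].
  by apply: ge_sup (Sub n); exists (q 0%N - 1%:R^-1), 0%N.
exists f; split; last by move=> z; exists z.
have sep z z' n : rev_prefix z n = rev_prefix z' n ->
    z n = false -> z' n = true -> f z < f z'.
  move=> zz' zn z'n.
  have EE : E z n = E z' n by rewrite /E zz'.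
  have [_ [t1 [t2 [t12 t1P t2P]]]] := stepP (n, E z n) (Epos z n).
  apply: le_lt_trans (lt_le_trans t12 _).
    apply/ler_addgt0Pr => e e0; have [w] := Elim z _ (fP z) e n.+1 e0.
    rewrite /E ES zn => /t1P wt; rewrite ltr_distl => /andP[_ /ltW fw].
    by rewrite (le_trans fw)// lerD2r.
  apply/ler_addgt0Pr => e e0; have [w] := Elim z' _ (fP z') e n.+1 e0.
  rewrite /E ES z'n -EE => /t2P wt; rewrite ltr_distlC => /andP[_ /ltW fw].
  exact: le_trans fw.
move=> z z' fzz'; apply: contrapT => /rev_prefix_split[n [pre]].
case zn : (z n); case z'n : (z' n) => // _.
  by have := sep _ _ _ (esym pre) z'n zn; rewrite fzz' ltxx.
by have := sep _ _ _ pre zn z'n; rewrite fzz' ltxx.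
Qed.

(** * Continuum many fibres *)

Lemma continuum_many_sub (T : Type) (A B : set T) :
  A `<=` B -> continuum_many A -> continuum_many B.
Proof. by move=> AB [f [finj fA]]; exists f; split=> // z; exact/AB/fA. Qed.

(** A diagonal argument in the manner of Koenig. Identify the continuum [C] with
    the sequences in [C], and let [rank z] be the index of the point attached to
    [z] in a fixed enumeration of its fibre. For some [n] the sequences of rank
    [n] have all possible [n]-th terms, for otherwise picking a missed value for
    each [n] gives a sequence without rank. On sequences of a fixed rank the map
    is injective, and choosing one for each [n]-th term concludes. *)
Lemma continuum_many_image (T U : Type) (A : set T) (g : T -> U) :
  (forall u, countable (g @^-1` [set u])) ->
  continuum_many A -> continuum_many (g @` A).
Proof.
move=> ctbl [f [finj fA]].
have /choice[r rinj] u : exists r : T -> nat, {in g @^-1` [set u] &, injective r}.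
  exact/countable_injP.
pose enc (z : nat -> nat -> bool) : nat -> bool :=
  fun i => if unpickle i is Some mk then z mk.1 mk.2 else false.
have enc_inj : injective enc.
  move=> z z' zz'; apply/funext => m; apply/funext => k.
  by have := congr1 (@^~ (pickle (m, k))) zz'; rewrite /enc pickleK.
pose rank z := r (g (f (enc z))) (f (enc z)).
have [n nP] : exists n, forall c, exists z, z n = c /\ rank z = n.
  apply: contrapT => /forallNP nn.
  have /choice[c cP] n : exists c, ~ exists z, z n = c /\ rank z = n.
    exact/existsNP/nn.
  by apply: (cP (rank c)); exists c.
have /choice[s sP] := nP.
exists (fun c => g (f (enc (s c)))); split; last by move=> c; exists (f (enc (s c))).
move=> c c' gg; rewrite -(sP c).1 -(sP c').1; congr (_ n).
apply/enc_inj/finj/(rinj (g (f (enc (s c))))).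
- by rewrite inE.
- by rewrite inE /preimage /= gg.
- by rewrite {2}gg; exact: etrans (sP c).2 (esym (sP c').2).
Qed.

(** * Well-orders and injective choices *)

Lemma well_founded_min (T : Type) (lt : T -> T -> Prop) (A : set T) :
  well_founded lt -> A !=set0 ->
  exists m, A m /\ forall s, lt s m -> ~ A s.
Proof.
move=> wf [a Aa]; apply: contrapT => nm.
suff nA t : ~ A t by exact: nA Aa.
elim/(well_founded_ind wf): t => t IH At.
by apply: nm; exists t.
Qed.

(** Well-foundedness rather than minima is what recursion requires. *)
Lemma strict_well_order (T : Type) : exists lt : T -> T -> Prop,
  well_founded lt /\ forall s t, s <> t -> lt s t \/ lt t s.
Proof.
have [le wo] := wochoice.well_ordering_principle {classic T}.
have anti : antisymmetric le.
  apply: in2T; apply: (@wochoice.wo_chain_antisymmetric _ _ predT).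
  exact: wochoice.withinW wo.
exists (fun s t => le s t /\ s <> t); split.
  move=> x; apply: contrapT => nx.
  pose A : {pred {classic T}} :=
    fun y => `[< ~ Acc (fun s t : T => le s t /\ s <> t) y >].
  have [|m [[/asboolP nm mmin] _]] := wo A; first by exists x; apply/asboolP.
  apply: nm; constructor => y [ym nym]; apply: contrapT => ny; apply: nym.
  by apply: anti; rewrite ym mmin//; apply/asboolP.
move=> s t st.
have [|m [[mst mmin] _]] := wo [pred x : {classic T} | (x == s) || (x == t)].
  by exists s; rewrite inE eqxx.
move: mst mmin; rewrite inE => /orP[] /eqP -> mmin.
  by left; split=> //; apply: mmin; rewrite inE eqxx orbT.
by right; split=> [|ts]; [apply: mmin; rewrite inE eqxx|exact/st/esym].
Qed.

(** The order type is an initial ordinal: no proper initial segment is as large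
    as [T]. If some initial segment is, the order of the least such segment is
    transported to [T]. *)
Lemma initial_well_order (T : Type) : exists lt : T -> T -> Prop,
  [/\ well_founded lt, forall s t, s <> t -> lt s t \/ lt t s &
    forall t, ~ exists f : T -> T, injective f /\ forall s, lt (f s) t].
Proof.
have [lt [wf tot]] := strict_well_order T.
pose big := [set t | exists f : T -> T, injective f /\ forall s, lt (f s) t].
have [bigne|nbig] := pselect (big !=set0); last first.
  by exists lt; split=> // t bt; apply: nbig; exists t.
have [m [[j [jinj jm]] mmin]] := well_founded_min wf bigne.
exists (fun s t => lt (j s) (j t)); split.
- exact: (Inverse_Image.wf_inverse_image _ _ _ j wf).
- by move=> s t st; apply: tot => /jinj.
- move=> t [f [finj ft]]; apply: (mmin (j t)) => //.
  by exists (j \o f); split=> //; exact: inj_comp.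
Qed.

(** Recursion along [initial_well_order]: the values already used at stage [t]
    are indexed by a set smaller than [T], so they cannot exhaust [M t]. *)
Lemma injective_transversal (T : Type) (V : pointedType) (D : set T)
    (M : T -> set V) :
  (forall t, D t -> exists j : T -> V, injective j /\ forall s, M t (j s)) ->
  exists f : T -> V, (forall t, D t -> M t (f t)) /\
    forall s t, D s -> D t -> f s = f t -> s = t.
Proof.
move=> Mbig; have [lt [wf tot small]] := initial_well_order T.
pose pick t (rec : forall s, lt s t -> V) : V :=
  xget point [set v | M t v /\ forall s (st : lt s t), D s -> rec s st <> v].
pose f := Fix wf (fun=> V) pick.
have fE t : f t = pick t (fun s _ => f s).
  rewrite /f Fix_eq// => x g h gh.
  suff -> : g = h by [].
  by apply: functional_extensionality_dep => y; apply: functional_extensionality_dep.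
have fP t : D t -> M t (f t) /\ forall s, lt s t -> D s -> f s <> f t.
  move=> Dt.
  (* If every [j u] had been used before [t], mapping [u] to a stage using
     [j u] would embed [T] below [t]. *)
  pose Q := [set v | M t v /\ forall s, lt s t -> D s -> f s <> v].
  rewrite -/(Q (f t)) fE; apply: (@xgetPex _ _ Q).
  apply: contrapT => /forallNP nv; have [j [jinj jM]] := Mbig t Dt.
  have /choice[k kP] u : exists s, lt s t /\ f s = j u.
    apply: contrapT => ns; apply: (nv (j u)); split=> // s st _ fs.
    by apply: ns; exists s.
  apply: (small t); exists k; split=> [u u' kk|u]; last by case: (kP u).
  by apply: jinj; rewrite -(kP u).2 -(kP u').2 kk.
exists f; split=> [t /fP[]//|s t Ds Dt fst]; apply: contrapT => /tot[st|ts].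
  exact: (fP t Dt).2 st Ds fst.
exact: (fP s Ds).2 ts Dt (esym fst).
Qed.

(** * The two unions *)

(** The index set consists of a scheme and a boolean: the boolean asks each set
    of branch limits for two members of [P], one for the union and one for its
    complement. *)
Lemma bernstein_union (R : realType) (P : set (set R)) :
  partition P id [set: R] -> (forall X, P X -> countable X) ->
  exists A0 : set (set R), A0 `<=` P /\ forall c,
    continuum_many (branch_limits c : set R) ->
    (\bigcup_(X in A0) X) `&` branch_limits c !=set0 /\
    ~` (\bigcup_(X in A0) X) `&` branch_limits c !=set0.
Proof.
move=> [Pcov Ptriv _] Pctbl.
have /choice[piece pieceP] (x : R) : exists X, P X /\ X x.
  have : [set: R] x by [].
  by rewrite -Pcov => -[X PX Xx]; exists X.
pose T := ((seq bool -> rat) * bool)%type.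
pose D := [set t : T | continuum_many (branch_limits t.1 : set R)].
pose M (t : T) := [set X | P X /\ X `&` branch_limits t.1 !=set0].
pose code (t : T) (i : nat) : bool :=
  if unpickle i is Some (s, q, b) then (t.1 s == q) && (t.2 == b) else false.
have code_inj : injective code.
  move=> [c b] [c' b'] E.
  have Es s q b0 : (c s == q) && (b == b0) = (c' s == q) && (b' == b0).
    by have := congr1 (@^~ (pickle (s, q, b0))) E; rewrite /code pickleK.
  have cE s : c s = c' s /\ b = b'.
    by have := Es s (c s) b; rewrite !eqxx => /esym/andP[/eqP-> /eqP->].
  by congr (_, _); [apply/funext => s; case: (cE s)|case: (cE [::])].
have [|f [fM finj]] := @injective_transversal T (set R) D M.
  move=> t Dt; suff [h [hinj hM]] : continuum_many (M t).
    by exists (h \o code); split=> [|s]; [exact: inj_comp|exact: hM].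
  apply: (@continuum_many_sub _ (piece @` branch_limits t.1)).
    move=> _ [x cx <-]; have [PX Xx] := pieceP x.
    by split=> //; exists x.
  apply: continuum_many_image => // X.
  have [[x _ <-]|nX] := pselect (range piece X).
    apply: (@sub_countable _ _ _ (piece x)).
      apply: subset_card_le => y /= <-; by case: (pieceP y).
    by apply: Pctbl; case: (pieceP x).
  rewrite (_ : _ @^-1` _ = set0)//; apply/seteqP; split=> // x xX.
  by apply: nX; exists x.
pose A0 := [set f (c, true) | c in [set c | D (c, true)]].
exists A0; split; first by move=> _ [c /fM[PX _] <-].
move=> c cc; split.
  have [_ [x [fx cx]]] := fM (c, true) cc; exists x; split=> //.
  by exists (f (c, true)) => //; exists c.
have [PX [x [fx cx]]] := fM (c, false) cc; exists x; split=> // -[_ [c' cc' <-]] f'x.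
have [PX' _] := fM (c', true) cc'.
suff [] : (c, false) = (c', true) by [].
by apply: finj => //; apply: Ptriv => //; exists x.
Qed.

(** Countably many translates of one half-line cover the line. *)
Lemma ray_positive (R : realType) (I : set (set R)) (k : R) :
  sigma_ideal I -> proper_set_ideal I -> translation_invariant I ->
  ~ I [set x | k <= x].
Proof.
move=> idI pI tI Ik; apply: pI.
apply: (sigma_idealS idI (B := \bigcup_(m : nat) [set x : R | - m%:R <= x])).
  move=> x _; exists (Num.truncn `|x|).+1 => //=.
  by rewrite lerNl (le_trans (ler_norm _))// normrN ltW// truncnS_gt.
apply: (sigma_idealU idI) => m.
apply: (sigma_idealS idI _ (tI _ (- m%:R - k) Ik)) => x /= mx.
by exists (x - (- m%:R - k)); [rewrite /=; lra|rewrite addrC subrK].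
Qed.

(** Finite sets are bounded, so every member of [P] avoids a half-line starting
    at a natural number. *)
Lemma avoiding_ray_positive (R : realType) (I : set (set R)) (P : set (set R)) :
  sigma_ideal I -> proper_set_ideal I ->
  partition P id [set: R] -> (forall X, P X -> finite_set X) ->
  exists k : R, ~ I (\bigcup_(X in [set X | P X /\ X `&` [set x | k <= x] = set0]) X).
Proof.
move=> idI pI [Pcov _ _] Pfin; apply: contrapT => /forallNP nk; apply: pI.
apply: (sigma_idealS idI (B := \bigcup_(n : nat)
  \bigcup_(X in [set X | P X /\ X `&` [set x : R | n%:R <= x] = set0]) X)).
  move=> x; rewrite -Pcov => -[X PX Xx].
  have /finite_seqP[s sX] := Pfin X PX.
  have [n nP] : exists n : nat, forall y, y \in s -> y < n%:R.
    elim: (s) => [|y s' [n nP]]; first by exists 0%N.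
    exists (maxn n (Num.truncn `|y|).+1) => y'; rewrite inE => /orP[/eqP ->|].
      rewrite (le_lt_trans (ler_norm _))// (lt_le_trans (truncnS_gt _))//.
      by rewrite ler_nat leq_maxr.
    by move=> /nP /lt_le_trans; apply; rewrite ler_nat leq_maxl.
  exists n => //; exists X => //; split=> //; apply/seteqP; split=> // y [].
  by rewrite sX /= => /nP yn /(lt_le_trans yn); rewrite ltxx.
by apply: (sigma_idealU idI) => n; apply: contrapT; exact: nk.
Qed.

Theorem theorem3p4 (R : realType) (I : set (set R))
    (I_sigma_ideal : sigma_ideal I)
    (I_proper : proper_set_ideal I)
    (I_singletons : contains_singletons I)
    (I_borel_base : has_borel_base I)
    (I_translation : translation_invariant I)
    (P : set (set R))
    (P_partition : partition P id [set: R])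
    (P_finite : forall X : set R, P X -> finite_set X) :
  (exists A0 : set (set R), A0 `<=` P /\
     completely_nonmeasurable I (\bigcup_(X in A0) X)) /\
  (exists A1 : set (set R), A1 `<=` P /\
     nonmeasurable I (\bigcup_(X in A1) X) /\
     ~ completely_nonmeasurable I (\bigcup_(X in A1) X)).
Proof.
have [A0 [A0P A0c]] := bernstein_union P_partition
  (fun X PX => finite_set_countable (P_finite X PX)).
have kernel B : borel R B -> ~ I B ->
    exists c, branch_limits c `<=` B /\ continuum_many (branch_limits c : set R).
  by move=> /borel_analytic; exact: perfect_kernel.
have A0cnm : completely_nonmeasurable I (\bigcup_(X in A0) X).
  apply: completely_nonmeasurable_meets => // B bB nIB;
    have [c [cB /A0c[[x [Ax cx]] [y [nAy cy]]]]] := kernel B bB nIB.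
    by exists x; split=> //; exact: cB.
  by exists y; split=> //; exact: cB.
split; first by exists A0.
have [k nIN] := avoiding_ray_positive I_sigma_ideal I_proper P_partition P_finite.
set B := [set x | k <= x] in nIN.
have bB : borel R B.
  rewrite (_ : B = ~` [set x | x < k]).
    by apply: sigma_algebraC; apply: sub_sigma_algebra; exact: open_lt.
  by apply/seteqP; split=> x /=; rewrite /B /= leNgt => /negP.
have nIB : ~ I B by exact: ray_positive.
set P' := [set X | P X /\ X `&` B = set0] in nIN.
have not_complete A1 : A1 `<=` P' ->
    ~ completely_nonmeasurable I (\bigcup_(X in A1) X).
  move=> A1P' /(_ B bB nIB); apply.
  rewrite (_ : _ `&` _ = set0); first exact: sigma_algebra0.
  apply/seteqP; split=> // x [[X /A1P'[_ XB0] Xx] Bx].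
  by rewrite -XB0; split.
(* The union [N] of [P'] is itself a witness unless it is measurable; in that
   case the members of [A0] in [P'] have the trace of [A0] on a Borel part of
   [N] outside [I]. *)
have [mN|nmN] := pselect (<<s borel R `|` I >> (\bigcup_(X in P') X)); last first.
  by exists P'; split; [move=> X []|split=> //; exact: not_complete].
exists (A0 `&` P'); split; first by move=> X [/A0P].
split; last by apply: not_complete => X [].
have [C [J [bC bJ IJ NC]]] := measurable_mod_ideal I_sigma_ideal I_borel_base mN.
have bCJ : borel R (C `\` J) by exact: sigma_algebraD.
have nICJ : ~ I (C `\` J).
  move=> ICJ; apply: nIN.
  apply: (sigma_idealS I_sigma_ideal _ (sigma_ideal_setU I_sigma_ideal ICJ IJ)).
  move=> x Nx; have [Jx|nJx] := pselect (J x); [by right|left].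
  by split=> //; apply/NC.
move=> mS; apply: (A0cnm _ bCJ nICJ).
rewrite (_ : _ `&` _ = (\bigcup_(X in A0 `&` P') X) `&` (C `\` J)).
  apply: sigma_algebraI => //.
  by apply: sub_sigma_algebra; left.
have [_ Ptriv _] := P_partition.
apply/seteqP; split=> [x [[X A0X Xx] [Cx nJx]]|x [[X [A0X _] Xx] CJx]]; last first.
  by split=> //; exists X.
split=> //; have [Y P'Y Yx] := (NC x nJx).2 Cx.
have XY : X = Y by apply: Ptriv; [exact: A0P|case: P'Y|exists x].
by exists X => //; split=> //; rewrite XY.
Qed.
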